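(* Let $c_1>c_2>0$, $c_3>0$ with $c_3/c_2\in\{1,1/2\}$, and $Q_*>0$. Put $c_{12}=c_1/c_2$, $c_{32}=c_3/c_2$ and $c_+=\sqrt{(c_1^2+c_2^2)/2}$. For $0\le v<c_2$ let $$\mathcal P_1^{sub}(v)=c_1^2c_3\sqrt{\frac{c_1^2+c_2^2-2v^2}{(c_1^2-v^2)(c_2^2-v^2)}}\;Q_*,$$ and for $c_+<v<c_1$ let $$\mathcal P_1^{sup}(v)=\frac{c_3c_1^2Q_*}{\sqrt{2v^2-c_1^2-c_2^2}}\sqrt{\frac{v^2-c_2^2}{c_1^2-v^2}}.$$ Then the minimum of $\mathcal P_1^{sub}$ over $[0,c_2)$ is reached at $v=0$ and equals $c_3^2Q_*\,\dfrac{c_{12}}{c_{32}}\sqrt{1+c_{12}^2}$. Moreover there is a constant $r$ with $|r-2.448515161|<10^{-9}$, the same for both values of $c_3/c_2$, such that whenever $c_1/c_2>r$ the supersonic threshold is below the subsonic one: $$\min_{c_+<v<c_1}\mathcal P_1^{sup}(v)<\min_{0\le v<c_2}\mathcal P_1^{sub}(v).$$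
   Context: $\mathcal P_1^{sub}(v)$ and $\mathcal P_1^{sup}(v)$ are the external forces on string 1 (with zero force $\mathcal P_2=0$ applied to string 2) needed for steady splitting at subsonic, respectively supersonic, speed $v$ in the continuous model of two strings (wave speeds $c_1,c_2$) connected by distributed bonds of stiffness $c_3^2$ and critical strain $Q_*$. The thresholds are the minimal such forces over the corresponding speed ranges. *)

(* Defs.v *)
From Stdlib Require Import Reals.
Open Scope R_scope.

(** The wave speeds of the two strings are [c1], [c2], the bonds have stiffness
    [c3 ^ 2] and critical strain [Qs].  [Rdiv] and [sqrt] are total: both forces
    below are meaningful only on the speed ranges that accompany them. *)

Definition c_plus (c1 c2 : R) : R := sqrt ((c1 ^ 2 + c2 ^ 2) / 2).

Definition sub_range (c2 v : R) : Prop := 0 <= v < c2.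

Definition sup_range (c1 c2 v : R) : Prop := c_plus c1 c2 < v < c1.

Definition P1_sub (c1 c2 c3 Qs v : R) : R :=
  c1 ^ 2 * c3
  * sqrt ((c1 ^ 2 + c2 ^ 2 - 2 * v ^ 2)
          / ((c1 ^ 2 - v ^ 2) * (c2 ^ 2 - v ^ 2)))
  * Qs.

Definition P1_sup (c1 c2 c3 Qs v : R) : R :=
  c3 * c1 ^ 2 * Qs / sqrt (2 * v ^ 2 - c1 ^ 2 - c2 ^ 2)
  * sqrt ((v ^ 2 - c2 ^ 2) / (c1 ^ 2 - v ^ 2)).

Definition min_reached_at (f : R -> R) (D : R -> Prop) (v0 : R) : Prop :=
  D v0 /\ forall v, D v -> f v0 <= f v.

(** A minimum is attained, as opposed to an infimum. *)
Definition is_min (f : R -> R) (D : R -> Prop) (m : R) : Prop :=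
  exists v0, min_reached_at f D v0 /\ f v0 = m.

(* Main.v *)
(** Write [A = c1^2], [B = c2^2], [w = v^2].  Up to the common factor [c1^2 c3 Q],
    the subsonic force is the square root of [1/(A-w) + 1/(B-w)], which increases
    with [w].  With [d = A - B] and [x = w - B], the supersonic force is the square
    root of [h], where [1/h = (2x-d)(d-x)/x = (3-2 sqrt 2) d - (sqrt 2 x - d)^2/x],
    so that its minimum is reached at [x = d / sqrt 2], where [h = (3+2 sqrt 2)/d].
    Comparing with [1/A + 1/B] and putting [s = A/B], [K = 3 + 2 sqrt 2], the
    supersonic minimum is the smaller one iff [K s < s^2 - 1], that is iff [s]
    exceeds the positive root of [s^2 - K s - 1].  This root does not depend on
    [c3], which enters both forces only through the common factor. *)
Require Import Defs.
From Stdlib Require Import Reals Lra Psatz.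
Open Scope R_scope.

(** The square of the silver ratio 1 + sqrt 2. *)
Definition silver_sq : R := 3 + 2 * sqrt 2.

Definition critical_ratio_sq : R := (silver_sq + sqrt (silver_sq ^ 2 + 4)) / 2.

Definition critical_ratio : R := sqrt critical_ratio_sq.

Lemma between_sqrt (a b x : R) :
  0 <= a -> 0 <= b -> a ^ 2 < x < b ^ 2 -> a < sqrt x < b.
Proof.
intros ha hb [hax hxb]; split.
- rewrite <- (sqrt_pow2 a ha); apply sqrt_lt_1_alt; split; [apply pow2_ge_0 | exact hax].
- rewrite <- (sqrt_pow2 b hb); apply sqrt_lt_1_alt; split; [| exact hxb].
  pose proof (pow2_ge_0 a); lra.
Qed.

Lemma sqrt2_bounds : 1.4142135623730 < sqrt 2 < 1.4142135623731.
Proof. apply between_sqrt; lra. Qed.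

Lemma critical_ratio_sq_bounds : 5.9952264935 < critical_ratio_sq < 5.995226495.
Proof.
unfold critical_ratio_sq, silver_sq.
pose proof sqrt2_bounds as ht.
pose proof (sqrt_sqrt 2 ltac:(lra)) as ht2.
(* As [sqrt 2] squares to 2, the radicand is 21 + 12 sqrt 2, linear in [sqrt 2]. *)
assert (hq : 6.162025863 < sqrt ((3 + 2 * sqrt 2) ^ 2 + 4) < 6.162025865)
  by (apply between_sqrt; nra).
lra.
Qed.

Lemma critical_ratio_bounds : Rabs (critical_ratio - 2.448515161) < 1 / 10 ^ 9.
Proof.
pose proof critical_ratio_sq_bounds as hs.
assert (h : 2.4485151601 < critical_ratio < 2.4485151619)
  by (apply between_sqrt; lra).
apply Rabs_def1; lra.
Qed.

Lemma critical_ratio_sq_root :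
  critical_ratio_sq ^ 2 = silver_sq * critical_ratio_sq + 1.
Proof.
unfold critical_ratio_sq.
pose proof (pow2_ge_0 silver_sq) as hK.
pose proof (pow2_sqrt (silver_sq ^ 2 + 4) ltac:(lra)) as hq.
nra.
Qed.

Lemma above_critical_ratio (c1 c2 : R) :
  c2 > 0 -> c1 / c2 > critical_ratio ->
  silver_sq * (c1 ^ 2 * c2 ^ 2) < (c1 ^ 2) ^ 2 - (c2 ^ 2) ^ 2.
Proof.
intros h2 hr.
pose proof critical_ratio_sq_bounds as hb.
pose proof critical_ratio_sq_root as hroot.
pose proof (sqrt_pos critical_ratio_sq) as hr0; fold critical_ratio in hr0.
pose proof (pow2_sqrt critical_ratio_sq ltac:(lra)) as hrr; fold critical_ratio in hrr.
set (y := c1 / c2) in *.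
replace c1 with (y * c2) by (unfold y; field; lra).
assert (hy : critical_ratio_sq < y ^ 2) by nra.
(* With s0 = [critical_ratio_sq] and K = [silver_sq], the root equation reads s0 (s0 - K) = 1. *)
assert (hK : silver_sq < critical_ratio_sq) by nra.
(* For s = y^2, s^2 - K s - 1 = (s - s0)(s + s0 - K), and both factors are positive. *)
assert (hs : silver_sq * y ^ 2 < (y ^ 2) ^ 2 - 1) by nra.
assert (hc : 0 < c2 ^ 4) by (apply pow_lt; lra).
nra.
Qed.

Lemma sub_radicand_split (A B w : R) :
  w < B -> B < A ->
  (A + B - 2 * w) / ((A - w) * (B - w)) = / (A - w) + / (B - w).
Proof. intros; field; lra. Qed.

Lemma P1_sub_min (c1 c2 c3 Qs : R) :
  c1 > c2 -> c2 > 0 -> c3 > 0 -> Qs > 0 ->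
  min_reached_at (P1_sub c1 c2 c3 Qs) (sub_range c2) 0.
Proof.
intros h12 h2 h3 hQ; split; [unfold sub_range; lra |].
intros v [hv0 hv]; unfold P1_sub.
apply Rmult_le_compat_r; [lra |].
apply Rmult_le_compat_l; [nra |].
apply sqrt_le_1_alt.
rewrite !sub_radicand_split by nra.
apply Rplus_le_compat; apply Rinv_le_contravar; nra.
Qed.

Lemma P1_sub_0 (c1 c2 c3 Qs : R) :
  c1 > c2 -> c2 > 0 ->
  P1_sub c1 c2 c3 Qs 0 = c3 * c1 ^ 2 * Qs * sqrt (/ c1 ^ 2 + / c2 ^ 2).
Proof.
intros h12 h2; unfold P1_sub.
rewrite sub_radicand_split by nra.
replace (0 ^ 2) with 0 by ring; rewrite !Rminus_0_r; ring.
Qed.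

(** The factor c3^2 c12 / c32 is c3 c1; the other c1 goes under the root. *)
Lemma P1_sub_0_ratio (c1 c2 c3 Qs : R) :
  c1 > c2 -> c2 > 0 -> c3 > 0 ->
  P1_sub c1 c2 c3 Qs 0
  = c3 ^ 2 * Qs * (c1 / c2 / (c3 / c2)) * sqrt (1 + (c1 / c2) ^ 2).
Proof.
intros h12 h2 h3; rewrite P1_sub_0 by lra.
replace (1 + (c1 / c2) ^ 2) with (c1 ^ 2 * (/ c1 ^ 2 + / c2 ^ 2)) by (field; lra).
rewrite sqrt_mult_alt by nra.
rewrite sqrt_pow2 by lra.
field; lra.
Qed.

Lemma sup_radicand_ge (d x : R) :
  d / 2 < x < d -> silver_sq / d <= x / ((2 * x - d) * (d - x)).
Proof.
intros hx; unfold silver_sq.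
pose proof sqrt2_bounds as ht.
pose proof (pow2_sqrt 2 ltac:(lra)) as ht2.
set (t := sqrt 2) in *.
assert (hD : 0 < (2 * x - d) * (d - x)) by (apply Rmult_lt_0_compat; lra).
assert (hid : x / ((2 * x - d) * (d - x)) - (3 + 2 * t) / d
              = (3 + 2 * t) * (t * x - d) ^ 2 / (d * ((2 * x - d) * (d - x)))).
(* The identity uses t^2 = 2, which [field] does not know: the two sides differ by an explicit
   multiple of t^2 - 2. *)
{ apply Rminus_diag_uniq.
  transitivity ((t ^ 2 - 2) * (2 * x * (2 * d - t * x) - 3 * x ^ 2)
                / (d * ((2 * x - d) * (d - x)))).
  - field; lra.
  - rewrite ht2; unfold Rdiv; ring. }
assert (0 <= (3 + 2 * t) * (t * x - d) ^ 2 / (d * ((2 * x - d) * (d - x)))).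
{ apply Rle_mult_inv_pos; [| apply Rmult_lt_0_compat; lra].
  apply Rmult_le_pos; [lra | apply pow2_ge_0]. }
lra.
Qed.

Lemma sup_radicand_opt (d x : R) :
  0 < d -> x = d * sqrt 2 / 2 -> x / ((2 * x - d) * (d - x)) = silver_sq / d.
Proof.
intros hd ->; unfold silver_sq.
pose proof sqrt2_bounds as ht.
pose proof (pow2_sqrt 2 ltac:(lra)) as ht2.
set (t := sqrt 2) in *.
(* Modulo t^2 = 2 the factor t / 2 of x splits off the denominator and cancels; then (3 + 2t)(3 -
   2t) = 1. *)
replace ((2 * (d * t / 2) - d) * (d - d * t / 2))
  with (d ^ 2 * (t / 2 * (3 - 2 * t))) by nra.
replace (3 + 2 * t) with (/ (3 - 2 * t)).
- field; lra.
- apply Rmult_eq_reg_r with (3 - 2 * t); [| lra].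
  rewrite Rinv_l by lra; nra.
Qed.

Lemma sup_range_sq (c1 c2 v : R) :
  c1 > c2 -> c2 > 0 ->
  sup_range c1 c2 v <-> 0 <= v /\ (c1 ^ 2 + c2 ^ 2) / 2 < v ^ 2 < c1 ^ 2.
Proof.
intros h12 h2; unfold sup_range, c_plus.
pose proof (sqrt_pos ((c1 ^ 2 + c2 ^ 2) / 2)) as hp.
pose proof (pow2_sqrt ((c1 ^ 2 + c2 ^ 2) / 2) ltac:(nra)) as hpp.
split; [intros []; repeat split; nra |].
intros [hv [hl hu]]; split; [| nra].
rewrite <- (sqrt_pow2 v hv); apply sqrt_lt_1_alt; nra.
Qed.

(** Since c_+^2 - c2^2 = d / 2, the speed range becomes d / 2 < x < d. There both factors of the
    denominator are positive, so the two roots merge into one. *)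
Lemma P1_sup_sqrt (c1 c2 c3 Qs v : R) :
  c1 > c2 -> c2 > 0 -> sup_range c1 c2 v ->
  let d := c1 ^ 2 - c2 ^ 2 in
  let x := v ^ 2 - c2 ^ 2 in
  d / 2 < x < d /\
  P1_sup c1 c2 c3 Qs v = c3 * c1 ^ 2 * Qs * sqrt (x / ((2 * x - d) * (d - x))).
Proof.
intros h12 h2 hv d x.
apply sup_range_sq in hv; [| lra | lra].
destruct hv as [hv hvv].
assert (hx : d / 2 < x < d) by (unfold d, x; lra).
split; [exact hx |].
unfold P1_sup.
replace (2 * v ^ 2 - c1 ^ 2 - c2 ^ 2) with (2 * x - d) by (unfold d, x; ring).
replace (c1 ^ 2 - v ^ 2) with (d - x) by (unfold d, x; ring).
fold x.
replace (x / ((2 * x - d) * (d - x))) with (x / (d - x) / (2 * x - d)) by (field; lra).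
rewrite (sqrt_div (x / (d - x))); [unfold Rdiv; ring | apply Rle_mult_inv_pos; lra | lra].
Qed.

Lemma P1_sup_min (c1 c2 c3 Qs : R) :
  c1 > c2 -> c2 > 0 -> c3 > 0 -> Qs > 0 ->
  is_min (P1_sup c1 c2 c3 Qs) (sup_range c1 c2)
    (c3 * c1 ^ 2 * Qs * sqrt (silver_sq / (c1 ^ 2 - c2 ^ 2))).
Proof.
intros h12 h2 h3 hQ.
pose proof sqrt2_bounds as ht.
(* This is d / sqrt 2, admissible because 1 < sqrt 2 < 2; the optimal speed follows from v^2 = c2^2
   + x. *)
set (x0 := (c1 ^ 2 - c2 ^ 2) * sqrt 2 / 2).
assert (hd : 0 < c1 ^ 2 - c2 ^ 2) by nra.
assert (hx0 : (c1 ^ 2 - c2 ^ 2) / 2 < x0 < c1 ^ 2 - c2 ^ 2) by (unfold x0; split; nra).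
set (v0 := sqrt (c2 ^ 2 + x0)).
assert (hv0 : v0 ^ 2 = c2 ^ 2 + x0) by (apply pow2_sqrt; nra).
assert (hr0 : sup_range c1 c2 v0)
  by (apply sup_range_sq; [lra | lra | split; [apply sqrt_pos | lra]]).
assert (hval : P1_sup c1 c2 c3 Qs v0
               = c3 * c1 ^ 2 * Qs * sqrt (silver_sq / (c1 ^ 2 - c2 ^ 2))).
{ destruct (P1_sup_sqrt c1 c2 c3 Qs v0 h12 h2 hr0) as [_ ->].
  rewrite sup_radicand_opt; [reflexivity | exact hd | fold x0; lra]. }
exists v0; split; [| exact hval].
split; [exact hr0 |]; intros v hv; rewrite hval.
destruct (P1_sup_sqrt c1 c2 c3 Qs v h12 h2 hv) as [hx ->].
apply Rmult_le_compat_l.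
- apply Rmult_le_pos; [apply Rmult_le_pos; [lra | apply pow2_ge_0] | lra].
- apply sqrt_le_1_alt, sup_radicand_ge, hx.
Qed.

Theorem mainTheorem6 :
  (forall c1 c2 c3 Qs : R,
     c1 > c2 -> c2 > 0 -> c3 > 0 ->
     c3 / c2 = 1 \/ c3 / c2 = 1 / 2 ->
     Qs > 0 ->
     let c12 := c1 / c2 in
     let c32 := c3 / c2 in
     min_reached_at (P1_sub c1 c2 c3 Qs) (sub_range c2) 0 /\
     is_min (P1_sub c1 c2 c3 Qs) (sub_range c2)
       (c3 ^ 2 * Qs * (c12 / c32) * sqrt (1 + c12 ^ 2)))
  /\
  (exists r : R,
     Rabs (r - 2.448515161) < 1 / 10 ^ 9 /\
     forall c1 c2 c3 Qs : R,
       c1 > c2 -> c2 > 0 -> c3 > 0 ->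
       c3 / c2 = 1 \/ c3 / c2 = 1 / 2 ->
       Qs > 0 ->
       c1 / c2 > r ->
       exists m_sup m_sub : R,
         is_min (P1_sup c1 c2 c3 Qs) (sup_range c1 c2) m_sup /\
         is_min (P1_sub c1 c2 c3 Qs) (sub_range c2) m_sub /\
         m_sup < m_sub).

Proof.
split.
- intros c1 c2 c3 Qs h12 h2 h3 _ hQ c12 c32.
  pose proof (P1_sub_min c1 c2 c3 Qs h12 h2 h3 hQ) as hmin.
  split; [exact hmin |].
  exists 0; split; [exact hmin |].
  apply P1_sub_0_ratio; assumption.
- exists critical_ratio; split; [exact critical_ratio_bounds |].
  intros c1 c2 c3 Qs h12 h2 h3 _ hQ hr.
  exists (c3 * c1 ^ 2 * Qs * sqrt (silver_sq / (c1 ^ 2 - c2 ^ 2))), (P1_sub c1 c2 c3 Qs 0).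
  split; [apply P1_sup_min; assumption |].
  split; [exists 0; split; [apply P1_sub_min; assumption | reflexivity] |].
  rewrite P1_sub_0 by assumption.
  assert (hA : 0 < c1 ^ 2) by (apply pow_lt; lra).
  assert (hB : 0 < c2 ^ 2) by (apply pow_lt; lra).
  assert (hd : 0 < c1 ^ 2 - c2 ^ 2) by nra.
  apply Rmult_lt_compat_l; [repeat apply Rmult_lt_0_compat; lra |].
  pose proof sqrt2_bounds as ht.
  apply sqrt_lt_1_alt; split; [apply Rle_mult_inv_pos; unfold silver_sq; lra |].
  pose proof (above_critical_ratio c1 c2 h2 hr) as hcmp.
  (* Multiplying by A B (A - B) > 0 clears all denominators: K / (A - B) becomes K A B, and 1/A +
     1/B becomes A^2 - B^2. *)
  apply Rmult_lt_reg_r with (c1 ^ 2 * c2 ^ 2 * (c1 ^ 2 - c2 ^ 2));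
    [repeat apply Rmult_lt_0_compat; lra |].
  replace (silver_sq / (c1 ^ 2 - c2 ^ 2) * (c1 ^ 2 * c2 ^ 2 * (c1 ^ 2 - c2 ^ 2)))
    with (silver_sq * (c1 ^ 2 * c2 ^ 2)) by (field; lra).
  replace ((/ c1 ^ 2 + / c2 ^ 2) * (c1 ^ 2 * c2 ^ 2 * (c1 ^ 2 - c2 ^ 2)))
    with ((c1 ^ 2) ^ 2 - (c2 ^ 2) ^ 2) by (field; lra).
  exact hcmp.
Qed.
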